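(* Let $\mathcal{D}$ be a cartesian monoidal category and $T$ a commutative monad on $\mathcal{D}$. Then the Kleisli category $\mathrm{Kl}_T$ of $T$ is weakly Markov if and only if $T$ is weakly affine.
   Context: A cartesian monoidal category is a category with finite products, regarded as a symmetric monoidal category with tensor $\times$ and unit the terminal object $1$; write $\mathrm{copy}_X\colon X\to X\times X$ for the diagonal and $\mathrm{del}_X\colon X\to 1$ for the unique map. Coherence isomorphisms are suppressed. A commutative monad $(T,\eta,\mu)$ on $\mathcal{D}$ is a strong monad whose left and right strengths commute; equivalently, a lax symmetric monoidal monad, with structure maps $c_{X,Y}\colon TX\times TY\to T(X\times Y)$ and unit map $\eta_1\colon 1\to T1$. A gs-monoidal category is a symmetric monoidal category $(\mathcal{C},\otimes,I)$ in which every object $X$ carries a commutative comonoid structure $\mathrm{copy}_X\colon X\to X\otimes X$, $\mathrm{del}_X\colon X\to I$, multiplicative with respect to the monoidal structure: $\mathrm{copy}_{X\otimes Y}$ equals $\mathrm{copy}_X\otimes\mathrm{copy}_Y$ followed by the swap of the two middle factors, $\mathrm{del}_{X\otimes Y}=\mathrm{del}_X\otimes\mathrm{del}_Y$, and the comonoid structure on $I$ is the trivial one (up to coherence isomorphisms). Naturality of $\mathrm{copy}$ and $\mathrm{del}$ is not required. For every object $X$ of a gs-monoidal category $\mathcal{C}$, the set $\mathcal{C}(X,I)$ is a commutative monoid with unit $\mathrm{del}_X$ and product $ab:=(a\otimes b)\circ\mathrm{copy}_X$ (using $I\otimes I\cong I$). The category $\mathcal{C}$ is called weakly Markov if for every object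 $X$ the monoid $\mathcal{C}(X,I)$ is a group. The Kleisli category $\mathrm{Kl}_T$ is gs-monoidal as follows. Its objects are those of $\mathcal{D}$; a morphism $f\colon X\to Y$ is represented by a morphism $f^\sharp\colon X\to TY$ of $\mathcal{D}$; the tensor is $\times$ on objects, and $f\otimes g$ is represented by $c\circ(f^\sharp\times g^\sharp)$; the unit object is $1$; the copy and discard morphisms are represented by $\eta\circ\mathrm{copy}_X$ and $\eta\circ\mathrm{del}_X$. The object $T1$ is canonically an internal commutative monoid in $\mathcal{D}$ with unit $\eta_1\colon 1\to T1$ and multiplication $T1\times T1\xrightarrow{c_{1,1}}T(1\times 1)\cong T1$. The monad $T$ is called weakly affine if $T1$ with this monoid structure is an internal group. *)

(* Defs.v *)
From mathcomp Require Import ssreflect.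

Set Implicit Arguments.
Unset Strict Implicit.
Unset Printing Implicit Defensive.

Declare Scope cat_scope.
Delimit Scope cat_scope with cat.
Local Open Scope cat_scope.

Record Category : Type := {
  ob :> Type;
  hom : ob -> ob -> Type;
  idm : forall X, hom X X;
  comp : forall X Y Z, hom Y Z -> hom X Y -> hom X Z;
  comp1m : forall X Y (f : hom X Y), comp (idm Y) f = f;
  compm1 : forall X Y (f : hom X Y), comp f (idm X) = f;
  compA : forall X Y Z W (h : hom Z W) (g : hom Y Z) (f : hom X Y),
    comp h (comp g f) = comp (comp h g) f
}.
Arguments hom {c} X Y.
Arguments idm {c} X.
Arguments comp {c X Y Z} g f.
Arguments comp1m {c X Y} f.
Arguments compm1 {c X Y} f.
Arguments compA {c X Y Z W} h g f.

Notation "g \o f" := (comp g f)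
  (at level 50, left associativity, format "g  \o  f") : cat_scope.

Record Iso (C : Category) (X Y : C) : Type := {
  iso_hom :> hom X Y;
  iso_inv : hom Y X;
  iso_homK : iso_inv \o iso_hom = idm X;
  iso_invK : iso_hom \o iso_inv = idm Y
}.
Arguments iso_inv {C X Y} i.

Record SymmetricMonoidalCategory : Type := {
  smc_cat :> Category;
  tens : smc_cat -> smc_cat -> smc_cat;
  tensm : forall X X' Y Y' : smc_cat,
    hom X X' -> hom Y Y' -> hom (tens X Y) (tens X' Y');
  munit : smc_cat;
  assoc : forall X Y Z : smc_cat, Iso (tens (tens X Y) Z) (tens X (tens Y Z));
  lunit : forall X : smc_cat, Iso (tens munit X) X;
  runit : forall X : smc_cat, Iso (tens X munit) X;
  braid : forall X Y : smc_cat, hom (tens X Y) (tens Y X);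

  tensm_id : forall X Y : smc_cat, tensm (idm X) (idm Y) = idm (tens X Y);
  tensm_comp : forall (X X' X'' Y Y' Y'' : smc_cat)
      (f' : hom X' X'') (f : hom X X') (g' : hom Y' Y'') (g : hom Y Y'),
    tensm (f' \o f) (g' \o g) = tensm f' g' \o tensm f g;

  assoc_nat : forall (X X' Y Y' Z Z' : smc_cat)
      (f : hom X X') (g : hom Y Y') (h : hom Z Z'),
    assoc X' Y' Z' \o tensm (tensm f g) h
    = tensm f (tensm g h) \o assoc X Y Z;
  lunit_nat : forall (X X' : smc_cat) (f : hom X X'),
    lunit X' \o tensm (idm munit) f = f \o lunit X;
  runit_nat : forall (X X' : smc_cat) (f : hom X X'),
    runit X' \o tensm f (idm munit) = f \o runit X;
  braid_nat : forall (X X' Y Y' : smc_cat) (f : hom X X') (g : hom Y Y'),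
    braid X' Y' \o tensm f g = tensm g f \o braid X Y;

  triangle : forall X Y : smc_cat,
    tensm (idm X) (lunit Y) \o assoc X munit Y = tensm (runit X) (idm Y);
  pentagon : forall X Y Z W : smc_cat,
    assoc X Y (tens Z W) \o assoc (tens X Y) Z W
    = tensm (idm X) (assoc Y Z W) \o assoc X (tens Y Z) W
      \o tensm (assoc X Y Z) (idm W);
  hexagon : forall X Y Z : smc_cat,
    assoc Y Z X \o braid X (tens Y Z) \o assoc X Y Z
    = tensm (idm Y) (braid X Z) \o assoc Y X Z \o tensm (braid X Y) (idm Z);
  braidK : forall X Y : smc_cat, braid Y X \o braid X Y = idm (tens X Y)
}.
Arguments tens {s} X Y.
Arguments tensm {s X X' Y Y'} f g.
Arguments munit {s}.
Arguments assoc {s} X Y Z.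
Arguments lunit {s} X.
Arguments runit {s} X.
Arguments braid {s} X Y.

Notation "X ** Y" := (tens X Y) (at level 40, left associativity) : cat_scope.
Notation "f *** g" := (tensm f g) (at level 40, left associativity) : cat_scope.

(* The swap of the two middle factors of [(X ** X) ** (Y ** Y)]. *)
Definition swap_mid (C : SymmetricMonoidalCategory) (X Y : C) :
    hom ((X ** X) ** (Y ** Y)) ((X ** Y) ** (X ** Y)) :=
  iso_inv (assoc X Y (X ** Y))
  \o (idm X *** (assoc Y X Y \o (braid X Y *** idm Y)
                 \o iso_inv (assoc X Y Y)))
  \o assoc X X (Y ** Y).

Record GSMonoidalCategory : Type := {
  gs_smc :> SymmetricMonoidalCategory;
  copy : forall X : gs_smc, hom X (X ** X);
  del : forall X : gs_smc, hom X munit;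
  copyA : forall X : gs_smc,
    assoc X X X \o (copy X *** idm X) \o copy X
    = (idm X *** copy X) \o copy X;
  copy_dell : forall X : gs_smc,
    lunit X \o (del X *** idm X) \o copy X = idm X;
  copy_delr : forall X : gs_smc,
    runit X \o (idm X *** del X) \o copy X = idm X;
  copyC : forall X : gs_smc, braid X X \o copy X = copy X;
  copy_tens : forall X Y : gs_smc,
    copy (X ** Y) = swap_mid X Y \o (copy X *** copy Y);
  del_tens : forall X Y : gs_smc,
    del (X ** Y) = lunit munit \o (del X *** del Y);
  copy_munit : copy munit = iso_inv (lunit munit);
  del_munit : del munit = idm munit
}.
Arguments copy {g} X.
Arguments del {g} X.

Record CommutativeMonoid : Type := {
  cm_car :> Type;
  cm_op : cm_car -> cm_car -> cm_car;
  cm_one : cm_car;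
  cm_opA : forall a b c, cm_op a (cm_op b c) = cm_op (cm_op a b) c;
  cm_opC : forall a b, cm_op a b = cm_op b a;
  cm_op1m : forall a, cm_op cm_one a = a
}.
Arguments cm_op {_} _ _.
Arguments cm_one {_}.

Definition is_group (M : CommutativeMonoid) : Prop :=
  forall a : M, exists b : M, cm_op a b = cm_one /\ cm_op b a = cm_one.

Definition effect_mul (C : GSMonoidalCategory) (X : C) (a b : hom X munit) :
    hom X munit :=
  lunit munit \o (a *** b) \o copy X.

Lemma lunit_runit_munit (C : GSMonoidalCategory) :
  iso_hom (runit (munit : C)) = lunit munit.
Proof.
have := copy_delr (munit : C).
rewrite del_munit tensm_id compm1 copy_munit => H.
by rewrite -[LHS]compm1 -(iso_homK (lunit munit)) compA H comp1m.
Qed.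

Lemma lunit_braid_munit (C : GSMonoidalCategory) :
  lunit munit \o braid munit munit = lunit (munit : C).
Proof.
have := copyC (munit : C); rewrite copy_munit => H.
rewrite -[LHS]compm1 -(iso_homK (lunit munit)) !compA.
by rewrite -(compA (lunit munit)) H iso_invK comp1m.
Qed.

Lemma effect_mulA (C : GSMonoidalCategory) (X : C) (a b c : hom X munit) :
  effect_mul a (effect_mul b c) = effect_mul (effect_mul a b) c.
Proof.
rewrite /effect_mul.
have -> : a *** (lunit munit \o (b *** c) \o copy X)
  = (idm munit *** lunit munit) \o (a *** (b *** c)) \o (idm X *** copy X).
  by rewrite -!tensm_comp comp1m compm1.
have -> : (lunit munit \o (a *** b) \o copy X) *** c
  = (lunit munit *** idm munit) \o ((a *** b) *** c) \o (copy X *** idm X).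
  by rewrite -!tensm_comp comp1m compm1.
rewrite -!compA -copyA (compA (tensm a _)) (compA (tensm a _) (assoc _ _ _)).
rewrite -assoc_nat !compA; congr (_ \o _ \o _ \o _).
by rewrite -!compA triangle lunit_runit_munit.
Qed.

Lemma effect_mulC (C : GSMonoidalCategory) (X : C) (a b : hom X munit) :
  effect_mul a b = effect_mul b a.
Proof.
rewrite /effect_mul -{1}(copyC X) compA; congr (_ \o _).
by rewrite -compA -braid_nat compA lunit_braid_munit.
Qed.

Lemma effect_mul1m (C : GSMonoidalCategory) (X : C) (a : hom X munit) :
  effect_mul (del X) a = a.
Proof.
have E : del X *** a = (idm munit *** a) \o (del X *** idm X).
  by rewrite -tensm_comp comp1m compm1.
by rewrite /effect_mul E compA lunit_nat -!compA (compA (lunit X)) copy_dell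
           compm1.
Qed.

Definition effect_monoid (C : GSMonoidalCategory) (X : C) :
    CommutativeMonoid := {|
  cm_car := hom X munit;
  cm_op := @effect_mul C X;
  cm_one := del X;
  cm_opA := @effect_mulA C X;
  cm_opC := @effect_mulC C X;
  cm_op1m := @effect_mul1m C X
|}.

Definition weakly_markov (C : GSMonoidalCategory) : Prop :=
  forall X : C, is_group (effect_monoid X).

Record CartesianCategory : Type := {
  cart_cat :> Category;
  one : cart_cat;
  bang : forall X : cart_cat, hom X one;
  bang_uniq : forall (X : cart_cat) (f : hom X one), f = bang X;
  prd : cart_cat -> cart_cat -> cart_cat;
  pr1 : forall X Y : cart_cat, hom (prd X Y) X;
  pr2 : forall X Y : cart_cat, hom (prd X Y) Y;
  pair : forall X Y Z : cart_cat, hom Z X -> hom Z Y -> hom Z (prd X Y);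
  pr1_pair : forall (X Y Z : cart_cat) (f : hom Z X) (g : hom Z Y),
    pr1 X Y \o pair f g = f;
  pr2_pair : forall (X Y Z : cart_cat) (f : hom Z X) (g : hom Z Y),
    pr2 X Y \o pair f g = g;
  pair_uniq : forall (X Y Z : cart_cat) (h : hom Z (prd X Y)),
    h = pair (pr1 X Y \o h) (pr2 X Y \o h)
}.
Arguments one {c}.
Arguments bang {c} X.
Arguments prd {c} X Y.
Arguments pr1 {c} X Y.
Arguments pr2 {c} X Y.
Arguments pair {c X Y Z} f g.

Section Cartesian.
Variable D : CartesianCategory.
Implicit Types X Y Z W : D.

Definition prdm X X' Y Y' (f : hom X X') (g : hom Y Y') :
    hom (prd X Y) (prd X' Y') :=
  pair (f \o pr1 X Y) (g \o pr2 X Y).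
Definition diag X : hom X (prd X X) := pair (idm X) (idm X).
Definition passoc X Y Z : hom (prd (prd X Y) Z) (prd X (prd Y Z)) :=
  pair (pr1 X Y \o pr1 (prd X Y) Z)
       (pair (pr2 X Y \o pr1 (prd X Y) Z) (pr2 (prd X Y) Z)).
Definition passoc_inv X Y Z : hom (prd X (prd Y Z)) (prd (prd X Y) Z) :=
  pair (pair (pr1 X (prd Y Z)) (pr1 Y Z \o pr2 X (prd Y Z)))
       (pr2 Y Z \o pr2 X (prd Y Z)).
Definition plunit X : hom (prd one X) X := pr2 one X.
Definition plunit_inv X : hom X (prd one X) := pair (bang X) (idm X).
Definition prunit X : hom (prd X one) X := pr1 X one.
Definition prunit_inv X : hom X (prd X one) := pair (idm X) (bang X).
Definition pbraid X Y : hom (prd X Y) (prd Y X) := pair (pr2 X Y) (pr1 X Y).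

Lemma pair_ext X Y Z (f g : hom Z (prd X Y)) :
  pr1 X Y \o f = pr1 X Y \o g -> pr2 X Y \o f = pr2 X Y \o g -> f = g.
Proof. by move=> e1 e2; rewrite (pair_uniq f) (pair_uniq g) e1 e2. Qed.

Lemma bang_ext X (f g : hom X one) : f = g.
Proof. by rewrite (bang_uniq f) (bang_uniq g). Qed.

Lemma pr1_pairA X Y Z W (f : hom Z X) (g : hom Z Y) (h : hom W Z) :
  pr1 X Y \o (pair f g \o h) = f \o h.
Proof. by rewrite compA pr1_pair. Qed.

Lemma pr2_pairA X Y Z W (f : hom Z X) (g : hom Z Y) (h : hom W Z) :
  pr2 X Y \o (pair f g \o h) = g \o h.
Proof. by rewrite compA pr2_pair. Qed.

End Cartesian.

Ltac cart_simpl :=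
  rewrite -?compA ?pr1_pairA ?pr2_pairA ?pr1_pair ?pr2_pair ?comp1m ?compm1.
Ltac cart :=
  try exact: bang_ext; repeat (progress cart_simpl);
  try reflexivity;
  try (apply: pair_ext; cart).
Ltac cart_solve :=
  intros;
  rewrite /passoc /passoc_inv /plunit /plunit_inv /prunit /prunit_inv
          /pbraid /prdm /diag; cart.

Section CartesianMonoidal.
Variable D : CartesianCategory.
Implicit Types X Y Z W : D.

Lemma passocK X Y Z : passoc_inv X Y Z \o passoc X Y Z = idm _.
Proof. cart_solve. Qed.
Lemma passoc_invK X Y Z : passoc X Y Z \o passoc_inv X Y Z = idm _.
Proof. cart_solve. Qed.
Lemma plunitK X : plunit_inv X \o plunit X = idm _.
Proof. cart_solve. Qed.
Lemma plunit_invK X : plunit X \o plunit_inv X = idm _.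
Proof. cart_solve. Qed.
Lemma prunitK X : prunit_inv X \o prunit X = idm _.
Proof. cart_solve. Qed.
Lemma prunit_invK X : prunit X \o prunit_inv X = idm _.
Proof. cart_solve. Qed.

Program Definition cartesian_smc : SymmetricMonoidalCategory := {|
  smc_cat := D;
  tens := prd;
  tensm := @prdm D;
  munit := one;
  assoc X Y Z := Build_Iso (passocK X Y Z) (passoc_invK X Y Z);
  lunit X := Build_Iso (plunitK X) (plunit_invK X);
  runit X := Build_Iso (prunitK X) (prunit_invK X);
  braid := @pbraid D
|}.
Solve All Obligations with cart_solve.

End CartesianMonoidal.

Record Endofunctor (C : Category) : Type := {
  fob :> C -> C;
  fmap : forall X Y : C, hom X Y -> hom (fob X) (fob Y);
  fmap_id : forall X : C, fmap (idm X) = idm (fob X);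
  fmap_comp : forall (X Y Z : C) (g : hom Y Z) (f : hom X Y),
    fmap (g \o f) = fmap g \o fmap f
}.
Arguments fmap {C} e {X Y} f.

Record Monad (C : Category) : Type := {
  monad_functor :> Endofunctor C;
  eta : forall X : C, hom X (monad_functor X);
  mu : forall X : C, hom (monad_functor (monad_functor X)) (monad_functor X);
  eta_nat : forall (X Y : C) (f : hom X Y),
    fmap monad_functor f \o eta X = eta Y \o f;
  mu_nat : forall (X Y : C) (f : hom X Y),
    fmap monad_functor f \o mu X
    = mu Y \o fmap monad_functor (fmap monad_functor f);
  mu_eta : forall X : C, mu X \o eta (monad_functor X) = idm _;
  mu_fmap_eta : forall X : C, mu X \o fmap monad_functor (eta X) = idm _;
  mu_mu : forall X : C,
    mu X \o mu (monad_functor X) = mu X \o fmap monad_functor (mu X)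
}.
Arguments eta {C} m X.
Arguments mu {C} m X.

Record StrongMonad (D : CartesianCategory) : Type := {
  strong_monad :> Monad D;
  strength : forall X Y : D,
    hom (prd X (strong_monad Y)) (strong_monad (prd X Y));
  strength_nat : forall (X X' Y Y' : D) (f : hom X X') (g : hom Y Y'),
    fmap strong_monad (prdm f g) \o strength X Y
    = strength X' Y' \o prdm f (fmap strong_monad g);
  strength_plunit : forall X : D,
    fmap strong_monad (plunit X) \o strength one X = plunit (strong_monad X);
  strength_passoc : forall X Y Z : D,
    fmap strong_monad (passoc X Y Z) \o strength (prd X Y) Z
    = strength X (prd Y Z) \o prdm (idm X) (strength Y Z)
      \o passoc X Y (strong_monad Z);
  strength_eta : forall X Y : D,
    strength X Y \o prdm (idm X) (eta strong_monad Y)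
    = eta strong_monad (prd X Y);
  strength_mu : forall X Y : D,
    strength X Y \o prdm (idm X) (mu strong_monad Y)
    = mu strong_monad (prd X Y) \o fmap strong_monad (strength X Y)
      \o strength X (strong_monad Y)
}.
Arguments strength {D} s X Y.

Definition costrength (D : CartesianCategory) (T : StrongMonad D) (X Y : D) :
    hom (prd (T X) Y) (T (prd X Y)) :=
  fmap T (pbraid Y X) \o strength T Y X \o pbraid (T X) Y.

Record CommutativeMonad (D : CartesianCategory) : Type := {
  comm_strong :> StrongMonad D;
  strength_comm : forall X Y : D,
    mu comm_strong (prd X Y) \o fmap comm_strong (strength comm_strong X Y)
      \o costrength comm_strong X (comm_strong Y)
    = mu comm_strong (prd X Y) \o fmap comm_strong (costrength comm_strong X Y)
      \o strength comm_strong (comm_strong X) Y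
}.

Definition mult (D : CartesianCategory) (T : CommutativeMonad D) (X Y : D) :
    hom (prd (T X) (T Y)) (T (prd X Y)) :=
  mu T (prd X Y) \o fmap T (strength T X Y) \o costrength T X (T Y).

(* An equation between composites of two arrows, usable inside a longer
   right-nested composite. *)
Lemma compR (C : Category) (X Y Y' Z W : C) (g : hom Y Z) (f : hom X Y)
    (g' : hom Y' Z) (f' : hom X Y') :
  g \o f = g' \o f' ->
  forall h : hom W X, g \o (f \o h) = g' \o (f' \o h).
Proof. by move=> e h; rewrite !compA e. Qed.

Lemma compR1 (C : Category) (X Y Z W : C) (g : hom Y Z) (f : hom X Y)
    (k : hom X Z) :
  g \o f = k -> forall h : hom W X, g \o (f \o h) = k \o h.
Proof. by move=> e h; rewrite !compA e. Qed.

(* Opaque copies, so that rewriting does not unfold these composites. *)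
Lemma costrength_lock (D : CartesianCategory) (T : StrongMonad D) :
  {s : forall X Y, hom (prd (T X) Y) (T (prd X Y))
     | forall X Y, s X Y = costrength T X Y}.
Proof. by exists (costrength T). Qed.

Lemma mult_lock (D : CartesianCategory) (T : CommutativeMonad D) :
  {m : forall X Y, hom (prd (T X) (T Y)) (T (prd X Y))
     | forall X Y, m X Y = mult T X Y}.
Proof. by exists (mult T). Qed.

Section CommutativeMonadTheory.
Variables (D : CartesianCategory) (T : CommutativeMonad D).
Implicit Types X Y Z W : D.

Notation t := (strength T).
Notation s := (proj1_sig (costrength_lock T)).
Notation m := (proj1_sig (mult_lock T)).
Notation F f := (fmap T f).
Notation "f # g" := (prdm f g) (at level 40, left associativity).

Lemma prdm_comp X X' X'' Y Y' Y'' (f' : hom X' X'') (f : hom X X')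
    (g' : hom Y' Y'') (g : hom Y Y') :
  (f' # g') \o (f # g) = (f' \o f) # (g' \o g).
Proof. cart_solve. Qed.

Lemma prdm_id X Y : idm X # idm Y = idm (prd X Y).
Proof. cart_solve. Qed.

Lemma pbraid_nat X X' Y Y' (f : hom X X') (g : hom Y Y') :
  pbraid X' Y' \o (f # g) = (g # f) \o pbraid X Y.
Proof. cart_solve. Qed.

Lemma pbraidK X Y : pbraid Y X \o pbraid X Y = idm _.
Proof. cart_solve. Qed.

Lemma passoc_nat X X' Y Y' Z Z' (f : hom X X') (g : hom Y Y') (h : hom Z Z') :
  passoc X' Y' Z' \o ((f # g) # h) = (f # (g # h)) \o passoc X Y Z.
Proof. cart_solve. Qed.

Lemma costrengthE X Y :
  s X Y = F (pbraid Y X) \o (t Y X \o pbraid (T X) Y).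
Proof. by rewrite (proj2_sig (costrength_lock T)) compA. Qed.

Lemma multE X Y : m X Y = mu T _ \o (F (t X Y) \o s X (T Y)).
Proof.
by rewrite (proj2_sig (mult_lock T)) (proj2_sig (costrength_lock T)) compA.
Qed.

Lemma fmapR1 X Y Z W (g : hom Y Z) (f : hom X Y) (k : hom X Z) :
  g \o f = k -> forall h : hom W (T X), F g \o (F f \o h) = F k \o h.
Proof. by move=> e h; rewrite compA -fmap_comp e. Qed.

Lemma fmapR X Y Z W (g : hom Y Z) (f : hom X Y) (h : hom W (T X)) :
  F g \o (F f \o h) = F (g \o f) \o h.
Proof. exact: fmapR1. Qed.

Lemma costrength_nat X X' Y Y' (f : hom X X') (g : hom Y Y') :
  F (f # g) \o s X Y = s X' Y' \o (F f # g).
Proof.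
rewrite !costrengthE -?compA pbraid_nat (compR (eq_sym (strength_nat T _ _))).
by rewrite !compA -!fmap_comp pbraid_nat.
Qed.

Lemma costrength_eta X Y : s X Y \o (eta T X # idm Y) = eta T (prd X Y).
Proof.
rewrite !costrengthE -?compA pbraid_nat (compR1 (strength_eta T _ _)).
by rewrite (compR (eta_nat T _)) pbraidK compm1.
Qed.

Lemma costrength_mu X Y :
  s X Y \o (mu T X # idm Y) = mu T _ \o (F (s X Y) \o s (T X) Y).
Proof.
rewrite !costrengthE -?compA pbraid_nat (compR1 (strength_mu T _ _)).
rewrite -?compA (compR (mu_nat T _)) !fmap_comp -?compA.
by rewrite (fmapR1 (pbraidK _ _)) fmap_id comp1m.
Qed.

Lemma strength_braid X Y : F (pbraid X Y) \o t X Y = s Y X \o pbraid X (T Y).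
Proof. by rewrite costrengthE -?compA pbraidK compm1. Qed.

Lemma costrength_braid X Y : F (pbraid X Y) \o s X Y = t Y X \o pbraid (T X) Y.
Proof.
by rewrite !costrengthE -?compA (fmapR1 (pbraidK _ _)) fmap_id comp1m.
Qed.

Lemma strengthC X Y : t X Y = F (pbraid Y X) \o (s Y X \o pbraid X (T Y)).
Proof. by rewrite (compR (costrength_braid _ _)) pbraidK compm1. Qed.

Lemma strength_comm' X Y :
  mu T (prd X Y) \o (F (t X Y) \o s X (T Y))
  = mu T (prd X Y) \o (F (s X Y) \o t (T X) Y).
Proof.
by rewrite !(proj2_sig (costrength_lock T)) compA strength_comm -compA.
Qed.

Lemma multE' X Y : m X Y = mu T _ \o (F (s X Y) \o t (T X) Y).
Proof. by rewrite multE strength_comm'. Qed.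

Lemma mult_nat X X' Y Y' (f : hom X X') (g : hom Y Y') :
  F (f # g) \o m X Y = m X' Y' \o (F f # F g).
Proof.
rewrite !multE -?compA (compR (mu_nat T _)) (fmapR1 (strength_nat T _ _)).
by rewrite fmap_comp -?compA costrength_nat.
Qed.

Lemma mult_eta_l X Y : m X Y \o (eta T X # idm (T Y)) = t X Y.
Proof.
rewrite multE -?compA costrength_eta eta_nat (compR1 (mu_eta T _)).
by rewrite comp1m.
Qed.

Lemma mult_eta_r X Y : m X Y \o (idm (T X) # eta T Y) = s X Y.
Proof.
rewrite multE' -?compA strength_eta eta_nat (compR1 (mu_eta T _)).
by rewrite comp1m.
Qed.

Lemma mult_eta X Y : m X Y \o (eta T X # eta T Y) = eta T (prd X Y).
Proof.
have -> : eta T X # eta T Y = (eta T X # idm _) \o (idm _ # eta T Y).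
  by rewrite prdm_comp comp1m compm1.
by rewrite compA mult_eta_l strength_eta.
Qed.

Lemma mult_braid X Y :
  F (pbraid X Y) \o m X Y = m Y X \o pbraid (T X) (T Y).
Proof.
rewrite multE multE' -?compA (compR (mu_nat T _)).
by rewrite (fmapR1 (strength_braid _ _)) fmap_comp -?compA costrength_braid.
Qed.

Lemma mult_plunit X : F (plunit X) \o (m one X \o (eta T one # idm _))
  = plunit (T X).
Proof. by rewrite mult_eta_l strength_plunit. Qed.

Lemma mult_prunit X : F (prunit X) \o (m X one \o (idm _ # eta T one))
  = prunit (T X).
Proof.
have E Y : prunit Y = plunit Y \o pbraid Y one by cart_solve.
rewrite mult_eta_r !E fmap_comp -compA costrength_braid.
by rewrite (compR1 (strength_plunit T _)).
Qed.

Lemma strength_mu_l X Y :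
  m X Y \o (idm _ # mu T Y) = mu T _ \o (F (t X Y) \o m X (T Y)).
Proof.
rewrite !multE -?compA.
have -> : idm (T X) # mu T Y = F (idm X) # mu T Y by rewrite fmap_id.
rewrite -costrength_nat (fmapR1 (strength_mu T _ _)).
rewrite !fmap_comp -?compA (compR (eq_sym (mu_mu T _))).
by rewrite (compR (mu_nat T _)).
Qed.

Lemma costrength_mu_l X Y :
  m X Y \o (mu T X # idm _) = mu T _ \o (F (s X Y) \o m (T X) Y).
Proof.
rewrite !multE' -?compA.
have -> : mu T X # idm (T Y) = mu T X # F (idm Y) by rewrite fmap_id.
rewrite -strength_nat (fmapR1 (costrength_mu _ _)).
rewrite !fmap_comp -?compA (compR (eq_sym (mu_mu T _))).
by rewrite (compR (mu_nat T _)).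
Qed.

Lemma mult_mu X Y :
  m X Y \o (mu T X # mu T Y)
  = mu T _ \o (F (m X Y) \o m (T X) (T Y)).
Proof.
have -> : mu T X # mu T Y = (idm _ # mu T Y) \o (mu T X # idm _).
  by rewrite prdm_comp comp1m compm1.
rewrite compA strength_mu_l -?compA costrength_mu_l.
rewrite (compR (mu_nat T _)) (compR (mu_mu T _)).
by rewrite !multE !fmap_comp -?compA.
Qed.

Lemma costrength_passoc X Y Z :
  s X (prd Y Z) \o passoc (T X) Y Z
  = F (passoc X Y Z) \o (s (prd X Y) Z \o (s X Y # idm Z)).
Proof.
pose r : hom (prd Z (prd Y X)) (prd (prd Y Z) X) :=
  (pbraid Z Y # idm X) \o passoc_inv Z Y X.
have rE : r = (pbraid Z Y # idm X) \o passoc_inv Z Y X by [].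
have tr : F r \o (t Z (prd Y X) \o (idm Z # t Y X))
  = t (prd Y Z) X \o ((pbraid Z Y # idm _) \o passoc_inv Z Y (T X)).
  have := strength_passoc T Z Y X.
  move/(f_equal (fun k => F r \o k \o passoc_inv Z Y (T X))).
  rewrite -?compA passoc_invK compm1 => <-.
  rewrite (compR1 (eq_sym (fmap_comp T _ _))) rE -?compA passocK compm1.
  by rewrite (compR (strength_nat T _ _)) fmap_id.
have e1 : pbraid (T X) (prd Y Z) \o passoc (T X) Y Z
  = (pbraid Z Y # idm _) \o passoc_inv Z Y (T X)
      \o ((idm Z # pbraid (T X) Y) \o pbraid (prd (T X) Y) Z) by cart_solve.
have e2 : pbraid X (prd Y Z) \o passoc X Y Z \o pbraid Z (prd X Y)
            \o (idm Z # pbraid Y X) = r by rewrite rE; cart_solve.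
have e3 : passoc X Y Z \o (pbraid Z (prd X Y) \o (idm Z # pbraid Y X))
  = pbraid (prd Y Z) X \o r by rewrite -e2; cart_solve.
rewrite !costrengthE -?compA e1 -?compA.
rewrite (compA (prdm (pbraid Z Y) _)) (compR (eq_sym tr)) -?compA.
rewrite (fmapR1 (eq_sym e3)) (pbraid_nat (F _ \o _)).
have -> : idm Z # (F (pbraid Y X) \o (t Y X \o pbraid (T X) Y))
  = (idm Z # F (pbraid Y X)) \o (idm Z # t Y X) \o (idm Z # pbraid (T X) Y).
  by rewrite !prdm_comp !comp1m -?compA.
by rewrite -?compA (compR (eq_sym (strength_nat T _ _))) !fmap_comp -?compA.
Qed.

Lemma bistrength_passoc X Y Z :
  t X (prd Y Z) \o (idm X # s Y Z) \o passoc X (T Y) Z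
  = F (passoc X Y Z) \o (s (prd X Y) Z \o (t X Y # idm Z)).
Proof.
pose w := passoc_inv X Z (T Y) \o ((idm X # pbraid (T Y) Z) \o passoc X (T Y) Z).
have e1 : (idm X # pbraid (T Y) Z) \o passoc X (T Y) Z = passoc X Z (T Y) \o w.
  by rewrite /w compA passoc_invK comp1m.
have e2 : pbraid (prd X (T Y)) Z
  = passoc Z X (T Y) \o ((pbraid X Z # F (idm Y)) \o w).
  by rewrite fmap_id /w; cart_solve.
have e3 : passoc X Y Z \o (pbraid Z (prd X Y)
            \o (passoc Z X Y \o (pbraid X Z # idm Y)))
  = (idm X # pbraid Z Y) \o passoc X Z Y by cart_solve.
have sp A B C : t A (prd B C) \o ((idm A # t B C) \o passoc A B (T C))
  = F (passoc A B C) \o t (prd A B) C by rewrite compA -strength_passoc.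
have -> : idm X # s Y Z
  = (idm X # F (pbraid Z Y)) \o ((idm X # t Z Y) \o (idm X # pbraid (T Y) Z)).
  by rewrite costrengthE !prdm_comp !comp1m.
rewrite -?compA e1 (compR (eq_sym (strength_nat T _ _))).
rewrite (compA (prdm _ (t Z Y))) (compR1 (sp _ _ _)) !costrengthE -?compA.
rewrite (pbraid_nat (t X Y)) e2 (compA (prdm _ (t X Y))) (compR1 (sp _ _ _)).
rewrite -?compA (compR (eq_sym (strength_nat T _ _))).
by rewrite !compA -!fmap_comp -?compA e3.
Qed.

Lemma mult_costrength X Y Z :
  m X (prd Y Z) \o ((idm (T X) # s Y Z) \o passoc (T X) (T Y) Z)
  = F (passoc X Y Z) \o (s (prd X Y) Z \o (m X Y # idm Z)).
Proof.
have -> : m X Y # idm Z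
  = (mu T _ # idm Z) \o ((F (t X Y) # idm Z) \o (s X (T Y) # idm Z)).
  by rewrite !prdm_comp !comp1m multE.
rewrite (compR1 (costrength_mu _ _)) -?compA.
rewrite (compR (eq_sym (costrength_nat _ _))) (compR (mu_nat T _)) multE -?compA.
have -> : idm (T X) # s Y Z = F (idm X) # s Y Z by rewrite fmap_id.
rewrite (compR (eq_sym (costrength_nat _ _))) costrength_passoc.
rewrite !fmapR; congr (_ \o (F _ \o _)).
by rewrite bistrength_passoc -?compA.
Qed.

Lemma mult_passoc X Y Z :
  m X (prd Y Z) \o ((idm (T X) # m Y Z) \o passoc (T X) (T Y) (T Z))
  = F (passoc X Y Z) \o (m (prd X Y) Z \o (m X Y # idm (T Z))).
Proof.
have -> : idm (T X) # m Y Z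
  = (idm _ # mu T _) \o ((F (idm X) # F (t Y Z)) \o (idm _ # s Y (T Z))).
  by rewrite fmap_id !prdm_comp !comp1m multE.
rewrite -?compA (compR1 (strength_mu_l _ _)) -?compA.
rewrite (compR (eq_sym (mult_nat _ _))) mult_costrength.
rewrite (multE (prd X Y)) -?compA (compR (mu_nat T _)).
rewrite !fmapR; congr (_ \o (F _ \o _)).
by rewrite strength_passoc -?compA.
Qed.

End CommutativeMonadTheory.

Section KleisliCategory.
Variables (C : Category) (T : Monad C).
Implicit Types X Y Z W : C.

Definition kcomp X Y Z (g : hom Y (T Z)) (f : hom X (T Y)) : hom X (T Z) :=
  mu T Z \o fmap T g \o f.

Lemma kcomp1m X Y (f : hom X (T Y)) : kcomp (eta T Y) f = f.
Proof. by rewrite /kcomp mu_fmap_eta comp1m. Qed.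

Lemma kcompm1 X Y (f : hom X (T Y)) : kcomp f (eta T X) = f.
Proof. by rewrite /kcomp -compA eta_nat compA mu_eta comp1m. Qed.

Lemma kcompA X Y Z W (h : hom Z (T W)) (g : hom Y (T Z)) (f : hom X (T Y)) :
  kcomp h (kcomp g f) = kcomp (kcomp h g) f.
Proof.
rewrite /kcomp !fmap_comp -!compA (compR (eq_sym (mu_mu T _))).
by rewrite (compR (mu_nat T _)).
Qed.

Definition Kleisli : Category := {|
  ob := C;
  hom X Y := hom X (T Y);
  idm X := eta T X;
  comp := kcomp;
  comp1m := kcomp1m;
  compm1 := kcompm1;
  compA := kcompA
|}.

Definition kpure X Y (f : hom X Y) : hom X (T Y) := eta T Y \o f.

Lemma kcomp_purel X Y Z (g : hom Y Z) (f : hom X (T Y)) :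
  kcomp (kpure g) f = fmap T g \o f.
Proof. by rewrite /kcomp /kpure fmap_comp compA mu_fmap_eta comp1m. Qed.

Lemma kcomp_purer X Y Z (g : hom Y (T Z)) (f : hom X Y) :
  kcomp g (kpure f) = g \o f.
Proof.
by rewrite /kcomp /kpure -!compA (compR (eta_nat T _)) (compR1 (mu_eta T _))
           comp1m.
Qed.

Lemma kpure_comp X Y Z (g : hom Y Z) (f : hom X Y) :
  kcomp (kpure g) (kpure f) = kpure (g \o f).
Proof. by rewrite kcomp_purer /kpure compA. Qed.

Lemma kpure_id X : kpure (idm X) = eta T X.
Proof. exact: compm1. Qed.

Lemma kpure_isoK X Y (i : Iso X Y) : kcomp (kpure (iso_inv i)) (kpure i) = eta T X.
Proof. by rewrite kpure_comp iso_homK kpure_id. Qed.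

Lemma kpure_iso_invK X Y (i : Iso X Y) :
  kcomp (kpure i) (kpure (iso_inv i)) = eta T Y.
Proof. by rewrite kpure_comp iso_invK kpure_id. Qed.

Definition kpure_iso X Y (i : Iso X Y) : @Iso Kleisli X Y :=
  @Build_Iso Kleisli X Y (kpure i) (kpure (iso_inv i))
    (kpure_isoK i) (kpure_iso_invK i).

End KleisliCategory.

Section KleisliMonoidal.
Variables (D : CartesianCategory) (T : CommutativeMonad D).
Implicit Types X Y Z W : D.

Definition ktensm X X' Y Y' (f : hom X (T X')) (g : hom Y (T Y')) :
    hom (prd X Y) (T (prd X' Y')) :=
  mult T X' Y' \o prdm f g.

Notation m := (proj1_sig (mult_lock T)).

Lemma ktensmE X X' Y Y' (f : hom X (T X')) (g : hom Y (T Y')) :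
  ktensm f g = m X' Y' \o prdm f g.
Proof. by rewrite (proj2_sig (mult_lock T)). Qed.

Lemma ktensm_pure X X' Y Y' (f : hom X X') (g : hom Y Y') :
  ktensm (kpure T f) (kpure T g) = kpure T (prdm f g).
Proof. by rewrite ktensmE /kpure -prdm_comp compA mult_eta. Qed.

Lemma ktensm_id X Y : ktensm (eta T X) (eta T Y) = eta T (prd X Y).
Proof. by rewrite ktensmE mult_eta. Qed.

Lemma ktensm_comp X X' X'' Y Y' Y'' (f' : hom X' (T X'')) (f : hom X (T X'))
    (g' : hom Y' (T Y'')) (g : hom Y (T Y')) :
  ktensm (kcomp f' f) (kcomp g' g) = kcomp (ktensm f' g') (ktensm f g).
Proof.
rewrite !ktensmE /kcomp -!compA -!prdm_comp (compR1 (mult_mu _ _ _)) -!compA.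
by rewrite fmap_comp -!compA (compR (mult_nat _ _ _)).
Qed.

Lemma kassoc_nat X X' Y Y' Z Z'
    (f : hom X (T X')) (g : hom Y (T Y')) (h : hom Z (T Z')) :
  kcomp (kpure T (passoc X' Y' Z')) (ktensm (ktensm f g) h)
  = kcomp (ktensm f (ktensm g h)) (kpure T (passoc X Y Z)).
Proof.
rewrite kcomp_purel kcomp_purer !ktensmE.
have -> : prdm (m X' Y' \o prdm f g) h
  = prdm (m X' Y') (idm _) \o prdm (prdm f g) h by rewrite prdm_comp comp1m.
have -> : prdm f (m Y' Z' \o prdm g h)
  = prdm (idm _) (m Y' Z') \o prdm f (prdm g h) by rewrite prdm_comp comp1m.
rewrite -!compA -passoc_nat !compA; congr (_ \o _).
by rewrite -!compA mult_passoc.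
Qed.

Lemma klunit_nat X X' (f : hom X (T X')) :
  kcomp (kpure T (plunit X')) (ktensm (eta T one) f)
  = kcomp f (kpure T (plunit X)).
Proof.
rewrite kcomp_purel kcomp_purer ktensmE.
have -> : prdm (eta T one) f = prdm (eta T one) (idm _) \o prdm (idm one) f.
  by rewrite prdm_comp compm1 comp1m.
rewrite (compA (m _ _)) mult_eta_l compA strength_plunit; cart_solve.
Qed.

Lemma krunit_nat X X' (f : hom X (T X')) :
  kcomp (kpure T (prunit X')) (ktensm f (eta T one))
  = kcomp f (kpure T (prunit X)).
Proof.
rewrite kcomp_purel kcomp_purer ktensmE.
have -> : prdm f (eta T one) = prdm (idm _) (eta T one) \o prdm f (idm one).
  by rewrite prdm_comp compm1 comp1m.
rewrite (compA (m _ _)) compA mult_prunit; cart_solve.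
Qed.

Lemma kbraid_nat X X' Y Y' (f : hom X (T X')) (g : hom Y (T Y')) :
  kcomp (kpure T (pbraid X' Y')) (ktensm f g)
  = kcomp (ktensm g f) (kpure T (pbraid X Y)).
Proof.
by rewrite kcomp_purel kcomp_purer !ktensmE -!compA -pbraid_nat !compA
           mult_braid.
Qed.

Let ktensm_pure1l X Y Y' (g : hom Y Y') :
  ktensm (eta T X) (kpure T g) = kpure T (prdm (idm X) g).
Proof. by rewrite -kpure_id ktensm_pure. Qed.

Let ktensm_pure1r X X' Y (f : hom X X') :
  ktensm (kpure T f) (eta T Y) = kpure T (prdm f (idm Y)).
Proof. by rewrite -kpure_id ktensm_pure. Qed.

Let pureE := (kpure_comp, ktensm_pure, ktensm_pure1l, ktensm_pure1r, ktensm_id).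

Program Definition kleisli_smc : SymmetricMonoidalCategory := {|
  smc_cat := Kleisli T;
  tens := @prd D;
  tensm := ktensm;
  munit := @one D;
  assoc X Y Z := kpure_iso T (assoc (s := cartesian_smc D) X Y Z);
  lunit X := kpure_iso T (lunit (s := cartesian_smc D) X);
  runit X := kpure_iso T (runit (s := cartesian_smc D) X);
  braid X Y := kpure T (pbraid X Y);
  tensm_id := ktensm_id;
  tensm_comp := ktensm_comp;
  assoc_nat := kassoc_nat;
  lunit_nat := klunit_nat;
  runit_nat := krunit_nat;
  braid_nat := kbraid_nat
|}.
Next Obligation.
by move=> * /=; rewrite !pureE; congr kpure; cart_solve.
Qed.
Next Obligation.
by move=> * /=; rewrite !pureE; congr kpure; cart_solve.
Qed.
Next Obligation.
by move=> * /=; rewrite !pureE; congr kpure; cart_solve.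
Qed.
Next Obligation.
by move=> * /=; rewrite !pureE pbraidK kpure_id.
Qed.

Program Definition kleisli_gs : GSMonoidalCategory := {|
  gs_smc := kleisli_smc;
  copy X := kpure T (diag X);
  del X := kpure T (bang X)
|}.
Next Obligation.
by move=> * /=; rewrite !pureE; congr kpure; cart_solve.
Qed.
Next Obligation.
by move=> * /=; rewrite !pureE -kpure_id; congr kpure; cart_solve.
Qed.
Next Obligation.
by move=> * /=; rewrite !pureE -kpure_id; congr kpure; cart_solve.
Qed.
Next Obligation.
by move=> * /=; rewrite !pureE; congr kpure; cart_solve.
Qed.
Next Obligation.
by move=> *; rewrite /swap_mid /= !pureE; congr kpure; cart_solve.
Qed.
Next Obligation.
by move=> * /=; rewrite !pureE; congr kpure; cart_solve.
Qed.
Next Obligation.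
by move=> * /=; congr kpure; cart_solve.
Qed.
Next Obligation.
by move=> * /=; rewrite -kpure_id; congr kpure; cart_solve.
Qed.

End KleisliMonoidal.

Record InternalCommutativeMonoid (D : CartesianCategory) : Type := {
  icm_ob :> D;
  icm_unit : hom one icm_ob;
  icm_mul : hom (prd icm_ob icm_ob) icm_ob;
  icm_mulA : icm_mul \o prdm (idm _) icm_mul \o passoc icm_ob icm_ob icm_ob
    = icm_mul \o prdm icm_mul (idm _);
  icm_mulC : icm_mul \o pbraid icm_ob icm_ob = icm_mul;
  icm_mul1m : icm_mul \o prdm icm_unit (idm _) = plunit icm_ob
}.

Definition is_internal_group (D : CartesianCategory)
    (M : InternalCommutativeMonoid D) : Prop :=
  exists inv : hom M M,
    icm_mul M \o prdm (idm M) inv \o diag M = icm_unit M \o bang M /\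
    icm_mul M \o prdm inv (idm M) \o diag M = icm_unit M \o bang M.

Section MonadOfUnit.
Variables (D : CartesianCategory) (T : CommutativeMonad D).

Definition tone_mul : hom (prd (T one) (T one)) (T one) :=
  fmap T (plunit one) \o mult T one one.

Notation m := (proj1_sig (mult_lock T)).

Let tone_mulE : tone_mul = fmap T (plunit one) \o m one one.
Proof. by rewrite (proj2_sig (mult_lock T)). Qed.

Lemma tone_mulA :
  tone_mul \o prdm (idm _) tone_mul \o passoc (T one) (T one) (T one)
  = tone_mul \o prdm tone_mul (idm _).
Proof.
have er : prdm (idm (T one)) (fmap T (plunit one) \o m one one)
  = prdm (fmap T (idm one)) (fmap T (plunit one)) \o prdm (idm _) (m one one).
  by rewrite prdm_comp fmap_id comp1m.
have el : prdm (fmap T (plunit one) \o m one one) (idm (T one))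
  = prdm (fmap T (plunit one)) (fmap T (idm one)) \o prdm (m one one) (idm _).
  by rewrite prdm_comp fmap_id comp1m.
rewrite !tone_mulE er el -!compA !(compR (eq_sym (mult_nat _ _ _))).
rewrite mult_passoc !fmapR; congr (fmap T _ \o _); cart_solve.
Qed.

Lemma tone_mulC : tone_mul \o pbraid (T one) (T one) = tone_mul.
Proof.
rewrite !tone_mulE -compA -mult_braid fmapR; congr (fmap T _ \o _); cart_solve.
Qed.

Lemma tone_mul1m : tone_mul \o prdm (eta T one) (idm _) = plunit (T one).
Proof. by rewrite tone_mulE -compA mult_plunit. Qed.

Definition tone_monoid : InternalCommutativeMonoid D := {|
  icm_ob := T one;
  icm_unit := eta T one;
  icm_mul := tone_mul;
  icm_mulA := tone_mulA;
  icm_mulC := tone_mulC;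
  icm_mul1m := tone_mul1m
|}.

Definition weakly_affine : Prop := is_internal_group tone_monoid.

End MonadOfUnit.

(* Main.v *)
From mathcomp Require Import ssreflect.
Require Import Defs.

(** An effect [X -> 1] of the Kleisli category is an arrow [X -> T one] of the
    base category, so the effects on [X] are the generalized elements of
    [T one] at stage [X].  The Kleisli product of effects is the product of
    generalized elements for the internal monoid [T one]
    ([kleisli_effect_mulE]), because composition with pure arrows is plain
    composition in the base; the two units agree as well.  The statement is
    then an instance of Yoneda: an internal monoid [M] is an internal group if
    and only if each monoid [hom X M] of generalized elements is a group.
    Pairs [a, b] of mutually inverse elements transform naturally in the
    stage: composition with an inversion arrow inverts every element, and,
    conversely, an inverse of the generic element [idm M] is itself an
    inversion arrow ([is_internal_groupP]). *)

Set Implicit Arguments.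
Unset Strict Implicit.
Unset Printing Implicit Defensive.

Local Open Scope cat_scope.

Section GeneralizedElements.
Variable D : CartesianCategory.
Implicit Types X Y Z : D.

Lemma prdm_diag X Y Z (f : hom X Y) (g : hom X Z) :
  prdm f g \o diag X = pair f g.
Proof. cart_solve. Qed.

Lemma pair_comp X Y Z W (f : hom Z X) (g : hom Z Y) (h : hom W Z) :
  pair f g \o h = pair (f \o h) (g \o h).
Proof. cart_solve. Qed.

(** The Yoneda argument.  Inverses at one stage suffice for all stages because
    the generic element [idm M] restricts to every other one. *)
Lemma is_internal_groupP (M : InternalCommutativeMonoid D) :
  is_internal_group M <->
  forall X (a : hom X M), exists b : hom X M,
    icm_mul M \o pair a b = icm_unit M \o bang X /\
    icm_mul M \o pair b a = icm_unit M \o bang X.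
Proof.
split=> [[inv []] | groupM].
  rewrite -!compA !prdm_diag => invr invl X a; exists (inv \o a).
  have -> : pair a (inv \o a) = pair (idm M) inv \o a.
    by rewrite pair_comp comp1m.
  have -> : pair (inv \o a) a = pair inv (idm M) \o a.
    by rewrite pair_comp comp1m.
  by rewrite !compA invr invl -!compA (bang_uniq (bang M \o a)).
have [inv [invr invl]] := groupM M (idm M).
by exists inv; rewrite -!compA !prdm_diag.
Qed.

End GeneralizedElements.

Lemma kleisli_effect_mulE (D : CartesianCategory) (T : CommutativeMonad D)
    (X : D) (a b : hom X (T one)) :
  effect_mul (C := kleisli_gs T) (X := X) a b = tone_mul T \o pair a b.
Proof.
rewrite /effect_mul /= kcomp_purer kcomp_purel /ktensm /tone_mul.
by rewrite -!compA prdm_diag.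
Qed.

Theorem proposition3p6 (D : CartesianCategory) (T : CommutativeMonad D) :
  weakly_markov (kleisli_gs T) <-> weakly_affine T.
Proof.
split=> [markovT | /is_internal_groupP affineT].
  apply/is_internal_groupP => X a; have [b [ab ba]] := markovT X a.
  by exists b; split; rewrite -kleisli_effect_mulE.
move=> X a; have [b [ab ba]] := affineT X a.
by exists b; split; rewrite [LHS]kleisli_effect_mulE.
Qed.
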